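(* Let $L$ be an $m\times k$ norming linear system over $\mathbb{F}_q$. Then there exists $\alpha:[k]\rightarrow\{0,1\}$ such that $(L,\alpha)$ is complex-norming.
   Context: $q$ is a prime power. An $m\times k$ linear system is a matrix $L\in\mathbb{F}_q^{m\times k}$ with linearly independent rows; for $G=\mathbb{F}_q^n$, $\mathrm{Sol}(L)=\{x\in G^k:\sum_j L_{ij}x_j=0\ \forall i\}$ and $t_L(f)=\frac{1}{|\mathrm{Sol}(L)|}\sum_{x\in\mathrm{Sol}(L)}\prod_j f(x_j)$. $L$ is norming if for every $n\ge 1$, $f\mapsto|t_L(f)|^{1/k}$ is a norm on the real vector space of real-valued functions on $\mathbb{F}_q^n$. For $\alpha:[k]\to\{0,1\}$ and $f:G\to\mathbb{C}$, $t_{L,\alpha}(f)=\frac{1}{|\mathrm{Sol}(L)|}\sum_{x\in\mathrm{Sol}(L)}\prod_{i=1}^k f(x_i)^{\alpha(i)}\overline{f(x_i)}^{1-\alpha(i)}$ (i.e. $f(x_i)$ is conjugated exactly when $\alpha(i)=0$). $(L,\alpha)$ is complex-norming if for every $n\ge1$, $f\mapsto|t_{L,\alpha}(f)|^{1/k}$ is a norm on the complex vector space of complex-valued functions on $\mathbb{F}_q^n$. *)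

(* Defs.v *)
From HB Require Import structures.
From mathcomp Require Import all_boot all_order all_algebra.
From mathcomp Require Import reals exp.
From mathcomp Require Import complex.

Set Implicit Arguments.
Unset Strict Implicit.
Unset Printing Implicit Defensive.

Import Order.TTheory GRing.Theory Num.Theory.

Local Open Scope ring_scope.
Local Open Scope complex_scope.

(* As for the norm operation of MathComp, the values lie in the scalar field K;
   over K = R[i] the condition 0 <= N v forces N v to be real. *)
Definition is_norm (K : numFieldType) (V : lmodType K) (N : V -> K) : Prop :=
  [/\ forall v : V, 0 <= N v,
      forall v : V, N v = 0 -> v = 0,
      forall (a : K) (v : V), N (a *: v) = `|a| * N v
    & forall u v : V, N (u + v) <= N u + N v].

Section LinearSystems.
(* F plays the role of F_q, with q = #|F|. *)
Variables (F : finFieldType) (m k : nat).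

Definition linear_system (L : 'M[F]_(m, k)) : bool := row_free L.

Definition Sol (n : nat) (L : 'M[F]_(m, k)) : {set {ffun 'I_k -> 'rV[F]_n}} :=
  [set x : {ffun 'I_k -> 'rV[F]_n} | [forall i, \sum_j L i j *: x j == 0]].

Definition t_real (R : realType) (n : nat) (L : 'M[F]_(m, k))
    (f : {ffun 'rV[F]_n -> R}) : R :=
  (#|Sol n L|%:R)^-1 * \sum_(x in Sol n L) \prod_(j < k) f (x j).

(* alpha i = true encodes alpha(i) = 1, alpha i = false encodes alpha(i) = 0. *)
Definition t_complex (R : realType) (n : nat) (L : 'M[F]_(m, k))
    (alpha : 'I_k -> bool) (f : {ffun 'rV[F]_n -> R[i]}) : R[i] :=
  (#|Sol n L|%:R)^-1 *
    \sum_(x in Sol n L) \prod_(i < k) (if alpha i then f (x i) else (f (x i))^*).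

(* For k = 0 the exponent k%:R^-1 is 0 and powR is constantly 1, which is not
   a norm, so that both notions below fail.  K^o is K as a vector space over
   itself, so the scalars of the function spaces are R and R[i] respectively. *)
Definition norming (R : realType) (L : 'M[F]_(m, k)) : Prop :=
  forall n : nat, (1 <= n)%N ->
    @is_norm R {ffun 'rV[F]_n -> R^o}
      (fun f => powR `|t_real L (f : {ffun 'rV[F]_n -> R})| k%:R^-1).

Definition complex_norming (R : realType) (L : 'M[F]_(m, k))
    (alpha : 'I_k -> bool) : Prop :=
  forall n : nat, (1 <= n)%N ->
    @is_norm R[i] {ffun 'rV[F]_n -> R[i]^o}
      (fun f => let t := t_complex L alpha (f : {ffun 'rV[F]_n -> R[i]}) in
                (powR (ComplexField.Normc.normc t) k%:R^-1)%:C).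

End LinearSystems.

(* Main.v *)
(** Let [T] be the [k]-linear form behind [t_L], let [f^a] be the family in
    which [f] is conjugated at the places where [a] is false, and let [M f] be
    the maximum of [|T (f^a)|] over all patterns [a].  Tensor products, i.e.
    functions [f x * g y] on [G1 * G2], make [T] multiplicative.

    Holder: [|T (g_1, ..., g_k)|^k <= M g_1 * ... * M g_k].  If all
    [M g_j <= 1], the real function [sum_j 2 Re (g_j (x) * conj (g_j (y)))] has
    norm at most [2 k], while expanding [t_L] of it gives a sum of squared
    moduli that contains [|T (g_1, ..., g_k)|^2]; the resulting constant is
    removed by the tensor power trick.

    [M] is multiplicative: if [a] and [b] attain [M f] and [M g] and agree at
    some place [j] (flip [a] otherwise), then Holder for the family
    [f^a_j (x) g^b_j] bounds [(M f * M g)^k] by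
    [M (f (x) g) * (M f * M g)^(k-1)].

    Hence one pattern attains [M f] for all [f] at once, since otherwise the
    tensor product of one counterexample per pattern would attain its maximum
    nowhere.  For that pattern the triangle inequality is Holder again. *)

Require Import Defs.
From mathcomp Require Import all_boot all_order all_algebra.
From mathcomp Require Import boolp reals exp complex lra.

Set Implicit Arguments.
Unset Strict Implicit.
Unset Printing Implicit Defensive.

Import Order.TTheory GRing.Theory Num.Theory.
Import ComplexField.Normc.

Local Open Scope ring_scope.
Local Open Scope complex_scope.

(** * Moduli and optional conjugation of complex numbers *)

Section ComplexModulus.
Variable R : realType.
Implicit Types z : R[i].

Lemma normc_ge0 z : 0 <= normc z.
Proof. by case: z => a b; exact: sqrtr_ge0. Qed.

Lemma normc_conj z : normc z^* = normc z.
Proof. by case: z => a b /=; rewrite sqrrN. Qed.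

Lemma normc_real (a : R) : normc a%:C = `|a|.
Proof. by rewrite /= expr0n addr0 sqrtr_sqr. Qed.

Lemma normc_prod (I : finType) (G : I -> R[i]) :
  normc (\prod_i G i) = \prod_i normc (G i).
Proof. exact: (big_morph _ (@normcM R) (normc1 R)). Qed.

Lemma normc_sum (I : finType) (G : I -> R[i]) :
  normc (\sum_i G i) <= \sum_i normc (G i).
Proof.
elim/big_ind2: _ => [|x1 x2 y1 y2 h1 h2|//]; first by rewrite normc0.
exact: le_trans (le_normcD _ _) (lerD h1 h2).
Qed.

Lemma mulr_conjc z : z * z^* = (normc z ^+ 2)%:C.
Proof. by rewrite rmorphXn -sqr_normc. Qed.

Definition conj_unless (b : bool) z : R[i] := if b then z else z^*.

Lemma conj_unlessM b z1 z2 :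
  conj_unless b (z1 * z2) = conj_unless b z1 * conj_unless b z2.
Proof. by case: b => //=; rewrite rmorphM. Qed.

Lemma conj_unlessD b z1 z2 :
  conj_unless b (z1 + z2) = conj_unless b z1 + conj_unless b z2.
Proof. by case: b => //=; rewrite rmorphD. Qed.

Lemma conj_unlessN b z : conj_unless (~~ b) z = (conj_unless b z)^*.
Proof. by case: b => //=; rewrite conjcK. Qed.

Lemma conj_unlessb b1 b2 z :
  conj_unless b1 (conj_unless b2 z) = conj_unless (b1 == b2) z.
Proof. by case: b1 b2 => [] [] //=; rewrite conjcK. Qed.

Lemma normc_conj_unless b z : normc (conj_unless b z) = normc z.
Proof. by case: b => //=; rewrite normc_conj. Qed.

End ComplexModulus.

(** * Bounded powers and [k]-th roots of reals *)

Section RealPowers.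
Variable R : realType.
Implicit Types x : R.

(** By Bernoulli's inequality the powers of a number above 1 are unbounded, even along the exponents
    [e i]. This is the limit step of the tensor power trick. *)
Lemma le1_of_bounded_powers x (K : R) (e : nat -> nat) :
  0 <= x -> (forall i, (i <= e i)%N) -> (forall i, x ^+ e i <= K) -> x <= 1.
Proof.
move=> x0 ge_e bnd; rewrite leNgt; apply/negP => x1.
have bernoulli n : 1 + n%:R * (x - 1) <= x ^+ n.
  elim: n => [|n IH]; first by rewrite mul0r addr0 expr0.
  rewrite exprSr; apply: le_trans (ler_wpM2r x0 IH).
  have := mulr_ge0 (ler0n R n) (sqr_ge0 (x - 1)).
  by rewrite -natr1; lra.
have x10 : 0 < x - 1 by lra.
pose i := Num.bound `|K / (x - 1)|.
have Ki : K < i%:R * (x - 1).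
  rewrite -ltr_pdivrMr //; apply: le_lt_trans (ler_norm _) _.
  exact: archi_boundP.
have ie : i%:R * (x - 1) <= (e i)%:R * (x - 1).
  by rewrite ler_wpM2r ?ler_nat // ltW.
by have := bernoulli (e i); have := bnd i; lra.
Qed.

Lemma powR_rootK x k : (0 < k)%N -> 0 <= x -> (x `^ k%:R^-1) ^+ k = x.
Proof.
move=> k0 x0; rewrite -powR_mulrn ?powR_ge0 // -powRrM mulVf ?powRr1 //.
by rewrite pnatr_eq0 -lt0n.
Qed.

Lemma powR_root x k : (0 < k)%N -> 0 <= x -> (x ^+ k) `^ k%:R^-1 = x.
Proof.
move=> k0 x0; rewrite -powR_mulrn // -powRrM mulfV ?powRr1 //.
by rewrite pnatr_eq0 -lt0n.
Qed.

Lemma powR_root_le x y k : (0 < k)%N -> 0 <= x -> 0 <= y ->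
  (x `^ k%:R^-1 <= y) = (x <= y ^+ k).
Proof.
move=> k0 x0 y0.
by rewrite -{2}(powR_rootK k0 x0) ler_pXn2r // nnegrE ?powR_ge0.
Qed.

End RealPowers.

(** * The form, its maximum over patterns, and tensor products *)

Section Forms.
Variables (R : realType) (F : finFieldType) (m k : nat) (L : 'M[F]_(m, k)).
Local Notation fn n := ('rV[F]_n -> R[i]).
Local Notation pattern := {ffun 'I_k -> bool}.

Definition mform n (g : 'I_k -> fn n) : R[i] :=
  (#|Sol n L|%:R)^-1 * \sum_(x in Sol n L) \prod_j g j (x j).

Definition conj_pattern n (a : pattern) (f : fn n) : 'I_k -> fn n :=
  fun j x => conj_unless (a j) (f x).

Definition maxform n (f : fn n) : R :=
  \big[Num.max/0]_(a : pattern) normc (mform (conj_pattern a f)).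

Definition tens n1 n2 (f : fn n1) (g : fn n2) : fn (n1 + n2)%N :=
  fun x => f (lsubmx x) * g (rsubmx x).

Lemma eq_mform n (g h : 'I_k -> fn n) :
  (forall j, g j =1 h j) -> mform g = mform h.
Proof.
move=> e; rewrite /mform; congr (_ * _); apply: eq_bigr => x _.
by apply: eq_bigr => j _; rewrite e.
Qed.

(** A linear equation on row vectors holds iff it holds on both blocks, so [row_mx] identifies pairs
    of solutions with solutions in dimension [n1 + n2]. *)
Lemma sum_Sol_tens n1 n2 (A : {ffun 'I_k -> 'rV[F]_n1} -> R[i])
    (B : {ffun 'I_k -> 'rV[F]_n2} -> R[i]) :
  \sum_(x in Sol (n1 + n2)%N L)
     A [ffun j => lsubmx (x j)] * B [ffun j => rsubmx (x j)]
  = (\sum_(x in Sol n1 L) A x) * (\sum_(y in Sol n2 L) B y).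
Proof.
rewrite big_distrlr /= pair_big /=.
pose h (p : {ffun 'I_k -> 'rV[F]_n1} * {ffun 'I_k -> 'rV[F]_n2}) :
  {ffun 'I_k -> 'rV[F]_(n1 + n2)} := [ffun j => row_mx (p.1 j) (p.2 j)].
have hl p : [ffun j => lsubmx (h p j)] = p.1.
  by apply/ffunP => j; rewrite !ffunE row_mxKl.
have hr p : [ffun j => rsubmx (h p j)] = p.2.
  by apply/ffunP => j; rewrite !ffunE row_mxKr.
rewrite (reindex h) /=; last first.
  exists (fun x => ([ffun j => lsubmx (x j)], [ffun j => rsubmx (x j)])).
    by move=> [p1 p2] _; rewrite hl hr.
  by move=> x _; apply/ffunP => j; rewrite !ffunE hsubmxK.
apply: eq_big => [p|p _]; last by rewrite hl hr.
have split_row i : (\sum_j L i j *: h p j == 0) =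
    (\sum_j L i j *: p.1 j == 0) && (\sum_j L i j *: p.2 j == 0).
  rewrite -row_mx_eq0; congr (_ == 0).
  rewrite -[LHS]hsubmxK !linear_sum /=; congr row_mx; apply: eq_bigr => j _.
    by rewrite linearZ /= ffunE row_mxKl.
  by rewrite linearZ /= ffunE row_mxKr.
rewrite !inE; apply/forallP/andP => [h0|[/forallP h1 /forallP h2] i].
  by split; apply/forallP => i; have := h0 i; rewrite split_row => /andP[].
by rewrite split_row h1 h2.
Qed.

Lemma card_Sol_tens n1 n2 :
  #|Sol (n1 + n2)%N L| = (#|Sol n1 L| * #|Sol n2 L|)%N.
Proof.
have := @sum_Sol_tens n1 n2 (fun=> 1) (fun=> 1).
under eq_bigr do rewrite mulr1.
by rewrite !sumr_const -natrM => /eqP; rewrite eqr_nat => /eqP.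
Qed.

Lemma mform_tens n1 n2 (f : 'I_k -> fn n1) (g : 'I_k -> fn n2) :
  mform (fun j => tens (f j) (g j)) = mform f * mform g.
Proof.
rewrite /mform card_Sol_tens natrM invfM mulrACA -sum_Sol_tens.
congr (_ * _); apply: eq_bigr => x _; rewrite -big_split /=.
by apply: eq_bigr => j _; rewrite !ffunE.
Qed.

Lemma mform_conj n (g : 'I_k -> fn n) :
  mform (fun j x => (g j x)^*) = (mform g)^*.
Proof.
rewrite /mform [RHS]rmorphM /= conjc_inv conjc_nat rmorph_sum; congr (_ * _).
by apply: eq_bigr => x _; rewrite rmorph_prod.
Qed.

Lemma mformZ n (c : 'I_k -> R[i]) (g : 'I_k -> fn n) :
  mform (fun j x => c j * g j x) = (\prod_j c j) * mform g.
Proof.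
rewrite /mform [RHS]mulrCA [X in _ = _ * X]big_distrr; congr (_ * _).
apply: eq_bigr => x _ /=.
by rewrite big_split.
Qed.

Lemma mform_sum n (I : finType) (h : 'I_k -> I -> fn n) :
  mform (fun j x => \sum_i h j i x) =
  \sum_(w : {ffun 'I_k -> I}) mform (fun j => h j (w j)).
Proof.
rewrite /mform -big_distrr exchange_big; congr (_ * _).
by apply: eq_bigr => x _; rewrite bigA_distr_bigA.
Qed.

Lemma mform_eq0 n (g : 'I_k -> fn n) j : g j =1 (fun=> 0) -> mform g = 0.
Proof.
move=> gj0; rewrite /mform big1 ?mulr0 // => x _.
by rewrite (bigD1 j) //= gj0 mul0r.
Qed.

Lemma maxform_ge0 n (f : fn n) : 0 <= maxform f.
Proof. exact: bigmax_ge_id. Qed.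

Lemma le_maxform n (a : 'I_k -> bool) (f : fn n) :
  normc (mform (fun j x => conj_unless (a j) (f x))) <= maxform f.
Proof.
apply: le_trans (le_bigmax _ _ [ffun j => a j]).
rewrite le_eqVlt; apply/orP; left; apply/eqP; congr normc.
by apply: eq_mform => j x; rewrite /conj_pattern ffunE.
Qed.

Lemma maxform_attained n (f : fn n) :
  exists a : pattern, maxform f = normc (mform (conj_pattern a f)).
Proof.
(* Moduli are nonnegative, so the default value [0] never beats a genuine pattern. *)
have := @eq_bigmax _ _ _ (0 : R) [ffun=> true] xpredT
  (fun a : pattern => normc (mform (conj_pattern a f))).
by case=> // [a _|a _ ?]; [exact: normc_ge0 | exists a].
Qed.

Lemma maxform_leP n (f : fn n) (K : R) :
  (forall a : pattern, normc (mform (conj_pattern a f)) <= K) ->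
  maxform f <= K.
Proof. by move=> h; have [a ->] := maxform_attained f. Qed.

(** Flipping every place conjugates the whole form. A maximizing pattern may thus be chosen true at
    a prescribed place. *)
Lemma normc_mform_patternN n (a : pattern) (f : fn n) :
  normc (mform (conj_pattern [ffun j => ~~ a j] f)) =
  normc (mform (conj_pattern a f)).
Proof.
rewrite -[RHS]normc_conj -mform_conj; congr normc; apply: eq_mform => j x.
by rewrite /conj_pattern ffunE conj_unlessN.
Qed.

Lemma maxform_attained_at n (f : fn n) (j0 : 'I_k) :
  exists2 a : pattern, a j0 & maxform f = normc (mform (conj_pattern a f)).
Proof.
have [a fa] := maxform_attained f.
have [aj|aj] := boolP (a j0); first by exists a.
by exists [ffun j => ~~ a j]; rewrite ?ffunE // normc_mform_patternN.
Qed.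

(** Conjugating [f] only permutes the patterns: [a] becomes [a j == b]. *)
Lemma maxform_conj_unless n b (f : fn n) :
  maxform (fun x => conj_unless b (f x)) <= maxform f.
Proof.
apply: maxform_leP => a; apply: le_trans (le_maxform (fun j => a j == b) f).
rewrite le_eqVlt; apply/orP; left; apply/eqP; congr normc.
by apply: eq_mform => j x; rewrite /conj_pattern conj_unlessb.
Qed.

Lemma maxformZ_le n (c : R[i]) (f : fn n) :
  maxform (fun x => c * f x) <= normc c ^+ k * maxform f.
Proof.
apply: maxform_leP => a.
rewrite (@eq_mform _ _ (fun j x => conj_unless (a j) c *
    conj_unless (a j) (f x))); last first.
  by move=> j x; rewrite /conj_pattern conj_unlessM.
rewrite mformZ normcM normc_prod.
under eq_bigr do rewrite normc_conj_unless.
rewrite prodr_const card_ord ler_wpM2l ?exprn_ge0 ?normc_ge0 //.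
exact: le_maxform.
Qed.

Lemma mform_pattern_tens n1 n2 (a : pattern) (f : fn n1) (g : fn n2) :
  mform (conj_pattern a (tens f g)) =
  mform (conj_pattern a f) * mform (conj_pattern a g).
Proof.
rewrite -mform_tens; apply: eq_mform => j x.
by rewrite /conj_pattern conj_unlessM.
Qed.

Lemma maxform_tens_le n1 n2 (f : fn n1) (g : fn n2) :
  maxform (tens f g) <= maxform f * maxform g.
Proof.
apply: maxform_leP => a; rewrite mform_pattern_tens normcM.
by rewrite ler_pM ?normc_ge0 // le_maxform.
Qed.


Lemma le_maxform_row n (I : finType) (g : I -> fn n) (w : 'I_k -> I * bool) i :
  (forall j, (w j).1 = i) ->
  normc (mform (fun j x => conj_unless (w j).2 (g (w j).1 x))) <= maxform (g i).
Proof.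
move=> wi; apply: le_trans (le_maxform (fun j => (w j).2) (g i)).
rewrite le_eqVlt; apply/orP; left; apply/eqP; congr normc.
by apply: eq_mform => j x; rewrite wi.
Qed.

(** * Expansions of [t_real] at real functions built from complex ones *)

Lemma t_realE n (f : {ffun 'rV[F]_n -> R}) :
  (t_real L f)%:C = mform (fun _ x => (f x)%:C).
Proof.
rewrite /t_real /mform rmorphM fmorphV rmorph_nat rmorph_sum; congr (_ * _).
by apply: eq_bigr => x _; rewrite rmorph_prod.
Qed.

Lemma t_real_Re n (f : fn n) :
  (t_real L [ffun x => 2 * complex.Re (f x)])%:C =
  \sum_(a : pattern) mform (conj_pattern a f).
Proof.
rewrite t_realE -(mform_sum (fun _ b x => conj_unless b (f x))).
apply: eq_mform => _ x.
by rewrite ffunE big_bool rmorphM rmorph_nat /= addcJ.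
Qed.

Definition square_real n (I : finType) (g : I -> fn n) :
    {ffun 'rV[F]_(n + n) -> R} :=
  [ffun x => \sum_i 2 * complex.Re (g i (lsubmx x) * (g i (rsubmx x))^*)].

(* A word [w] and its conjugate sit on the two factors, so every term of the
   expansion is a squared modulus. *)
Lemma t_real_square n (I : finType) (g : I -> fn n) :
  t_real L (square_real g) =
  \sum_(w : {ffun 'I_k -> I * bool})
    normc (mform (fun j x => conj_unless (w j).2 (g (w j).1 x))) ^+ 2.
Proof.
apply: (@complexI R); rewrite t_realE rmorph_sum.
pose h (p : I * bool) : fn (n + n)%N :=
  tens (fun x => conj_unless p.2 (g p.1 x))
       (fun x => conj_unless (~~ p.2) (g p.1 x)).
transitivity (mform (fun _ x => \sum_p h p x)).
  apply: eq_mform => _ x; rewrite ffunE rmorph_sum /= -(pair_big xpredT xpredT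
    (fun i b => h (i, b) x)) /=; apply: eq_bigr => i _.
  rewrite big_bool /h /tens /= rmorphM rmorph_nat /= -addcJ.
  by rewrite rmorphM /= conjcK.
rewrite mform_sum; apply: eq_bigr => w _.
rewrite [LHS](mform_tens (fun j x => conj_unless (w j).2 (g (w j).1 x))
  (fun j x => conj_unless (~~ (w j).2) (g (w j).1 x))).
rewrite /= -mulr_conjc; congr (_ * _); apply: etrans (mform_conj _).
by apply: eq_mform => j x; rewrite conj_unlessN.
Qed.

(** * Consequences of the norming hypothesis *)

Section Norming.
Hypothesis hnorming : norming R L.

Let N n (f : {ffun 'rV[F]_n -> R^o}) : R :=
  `|t_real L (f : {ffun 'rV[F]_n -> R})| `^ k%:R^-1.

Lemma norming_norm0 n : (0 < n)%N -> N (0 : {ffun 'rV[F]_n -> R^o}) = 0.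
Proof.
move=> n0; have [_ _ NZ _] := hnorming n0.
by rewrite -(scale0r (0 : {ffun 'rV[F]_n -> R^o})) [LHS]NZ normr0 mul0r.
Qed.

Lemma norming_gt0 : (0 < k)%N.
Proof.
rewrite lt0n; apply/negP => /eqP k0.
have k0' : k%:R^-1 = 0 :> R by rewrite k0 invr0.
have := @norming_norm0 1 isT; rewrite /N k0' powRr0.
by apply/eqP; rewrite oner_eq0.
Qed.

Lemma norming_sum n (I : finType) (f : I -> {ffun 'rV[F]_n -> R^o}) :
  (0 < n)%N -> N (\sum_i f i) <= \sum_i N (f i).
Proof.
move=> n0; have [_ _ _ ND] := hnorming n0.
elim/big_ind2: _ => [|x1 x2 y1 y2 h1 h2|//]; first by rewrite norming_norm0.
exact: le_trans (ND _ _) (lerD h1 h2).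
Qed.

Lemma norming_definite n (f : {ffun 'rV[F]_n -> R}) :
  (0 < n)%N -> t_real L f = 0 -> f =1 (fun=> 0).
Proof.
move=> n0 tf; have [_ N0 _ _] := hnorming n0.
have : N f = 0.
  rewrite /N tf normr0 powR0 // invr_eq0 pnatr_eq0 -lt0n; exact: norming_gt0.
by move/N0 => e x; rewrite e ffunE.
Qed.

(** When all patterns vanish, so does the expansion of [t_real] at twice the real part, and
    definiteness of the real norm kills that part. Multiplying by ['i] gives the imaginary part. *)
Lemma maxform_eq0 n (f : fn n) :
  (0 < n)%N -> maxform f = 0 -> f =1 (fun=> 0).
Proof.
move=> n0.
have Re0 (g : fn n) x : maxform g = 0 -> complex.Re (g x) = 0.
  move=> g0.
  have tg0 : t_real L [ffun x => 2 * complex.Re (g x)] = 0.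
    apply: (@complexI R); rewrite t_real_Re big1 // => a _.
    apply: eq0_normc; apply/eqP; rewrite eq_le normc_ge0 andbT -g0.
    exact: le_maxform.
  have /eqP := norming_definite n0 tg0 x.
  by rewrite ffunE mulf_eq0 pnatr_eq0 => /eqP.
move=> f0 x.
have if0 : maxform (fun x => 'i * f x) = 0.
  apply/eqP; rewrite eq_le maxform_ge0 andbT.
  by apply: le_trans (maxformZ_le _ _) _; rewrite f0 mulr0.
have := Re0 _ x if0; have := Re0 _ x f0.
case: (f x) => a b /= -> /eqP; rewrite mul0r mul1r sub0r oppr_eq0 => /eqP ->.
by [].
Qed.

Lemma t_real_square_le n (g : 'I_k -> fn n) :
  (0 < n)%N -> (forall j, maxform (g j) <= 1) ->
  t_real L (square_real g) <= (2 * k)%:R ^+ k.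
Proof.
move=> n0 g1; have k0 := norming_gt0.
have nn0 : (0 < n + n)%N by rewrite addn_gt0 n0.
have t_ge0 (I : finType) (h : I -> fn n) : 0 <= t_real L (square_real h).
  by rewrite t_real_square sumr_ge0 // => w _; rewrite sqr_ge0.
rewrite -powR_root_le // ?t_ge0 //.
(* Splitting into one-function squares allows the triangle inequality; each summand will have norm
   at most 2. *)
have -> : t_real L (square_real g) `^ k%:R^-1 =
    N (\sum_j (square_real (fun _ : unit => g j) : {ffun _ -> R^o})).
  rewrite /N -[LHS](ger0_norm (powR_ge0 _ _)) norm_powR ?t_ge0 //.
  congr (`|t_real L _| `^ _); apply/ffunP => x; rewrite sum_ffunE ffunE.
  by apply: eq_bigr => j _; rewrite ffunE big_const card_unit /= addr0.
apply: le_trans (norming_sum _ nn0) _.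
apply: le_trans (_ : \sum_(j < k) (2 : R) <= _); last first.
  by rewrite sumr_const card_ord natrM mulr_natr.
apply: ler_sum => j _; rewrite /N ger0_norm ?t_ge0 //.
rewrite powR_root_le ?t_ge0 // t_real_square.
(* With a single function only the conjugations vary: [2 ^ k] words, each contributing at most 1. *)
apply: le_trans (_ : \sum_(w : {ffun 'I_k -> unit * bool}) (1 : R) <= _).
  apply: ler_sum => w _; rewrite expr_le1 ?normc_ge0 //.
  apply: le_trans (g1 j).
  by apply: (@le_maxform_row _ _ (fun=> g j) w tt) => i; case: (w i).1.
rewrite sumr_const card_ffun card_prod card_unit card_bool card_ord mul1n.
by rewrite natrX.
Qed.

Lemma normc_mform_square_le n (g : 'I_k -> fn n) :
  (0 < n)%N -> (forall j, maxform (g j) <= 1) ->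
  normc (mform g) ^+ 2 <= (2 * k)%:R ^+ k.
Proof.
move=> n0 g1; apply: le_trans (t_real_square_le n0 g1).
rewrite t_real_square (bigD1 [ffun j => (j, true)]) //=.
rewrite (@eq_mform _ (fun _ _ => conj_unless _ _) g) => [|j x]; last first.
  by rewrite ffunE.
by rewrite lerDl sumr_ge0 // => w _; rewrite sqr_ge0.
Qed.

(* Replacing every [g j] by its tensor product with its own conjugate squares
   the form, so the constant of the previous bound can be removed. *)
Lemma normc_mform_le1 n (g : 'I_k -> fn n) :
  (0 < n)%N -> (forall j, maxform (g j) <= 1) -> normc (mform g) <= 1.
Proof.
move=> n0 g1.
apply: (@le1_of_bounded_powers _ _ ((2 * k)%:R ^+ k) (fun i => 2 ^ i.+1)%N).
- exact: normc_ge0.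
- move=> i; apply: leq_trans (ltnW (ltn_expl i (ltnSn 1))) _.
  by rewrite leq_exp2l.
(* The base case bounds a square, hence the exponent [2 ^ i.+1]. The dimension doubles at each step,
   but the constant does not depend on it. *)
move=> i; elim: i n n0 g g1 => [|i IH] n n0 g g1.
  exact: normc_mform_square_le.
pose h j := tens (g j) (fun x => conj_unless false (g j x)).
have := IH (n + n)%N _ h; rewrite /h mform_tens mform_conj normcM normc_conj.
rewrite -expr2 -exprM -expnS; apply; first by rewrite addn_gt0 n0.
move=> j; apply: le_trans (maxform_tens_le _ _) _.
by rewrite mulr_ile1 ?maxform_ge0 // (le_trans (maxform_conj_unless _ _)).
Qed.

Lemma mform_holder n (g : 'I_k -> fn n) :
  (0 < n)%N -> normc (mform g) ^+ k <= \prod_j maxform (g j).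
Proof.
move=> n0; have k0 := norming_gt0.
have [/existsP[j /eqP gj]|/existsPn gn0] :=
  boolP [exists j, maxform (g j) == 0].
  rewrite (@mform_eq0 _ _ j); last exact: maxform_eq0.
  by rewrite normc0 expr0n gtn_eqF // prodr_ge0 // => i _; rewrite maxform_ge0.
(* [maxform] scales with the [k]-th power of the modulus, so dividing [g j] by [c j] brings it to at
   most 1. *)
pose c j := maxform (g j) `^ k%:R^-1.
have c_gt0 j : 0 < c j by rewrite powR_gt0 // lt_def gn0 maxform_ge0.
have ck j : c j ^+ k = maxform (g j) by rewrite powR_rootK ?maxform_ge0.
have := @normc_mform_le1 _ (fun j x => ((c j)^-1)%:C * g j x) n0.
rewrite mformZ normcM normc_prod.
under eq_bigr do rewrite normc_real gtr0_norm ?invr_gt0 //.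
rewrite prodfV mulrC ler_pdivrMr ?prodr_gt0 // mul1r => le1.
under [leRHS]eq_bigr do rewrite -ck.
rewrite prodrXl lerXn2r ?nnegrE ?normc_ge0 ?prodr_ge0 //.
  by move=> j _; exact: ltW.
apply: le1 => j; apply: le_trans (maxformZ_le _ _) _.
rewrite normc_real gtr0_norm ?invr_gt0 // -ck exprVn mulVf //.
by rewrite expf_neq0 ?gt_eqF.
Qed.

Lemma maxform_tens n1 n2 (f : fn n1) (g : fn n2) : (0 < n1)%N ->
  maxform (tens f g) = maxform f * maxform g.
Proof.
move=> n10; have k0 := norming_gt0; pose j0 := Ordinal k0.
apply/eqP; rewrite eq_le maxform_tens_le /=.
have [/eqP P0|Pn0] := boolP (maxform f * maxform g == 0).
  by rewrite P0 maxform_ge0.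
have [a aj fa] := maxform_attained_at f j0.
have [b bj gb] := maxform_attained_at g j0.
have P_gt0 : 0 < maxform f * maxform g.
  by rewrite lt_def Pn0 mulr_ge0 ?maxform_ge0.
have := @mform_holder (n1 + n2)%N
  (fun j => tens (conj_pattern a f j) (conj_pattern b g j)).
rewrite mform_tens normcM -fa -gb addn_gt0 n10 => /(_ isT).
(* Both patterns are true at [j0], so that factor is [maxform (tens f g)]; the other [k - 1] are at
   most [maxform f * maxform g] and cancel. *)
rewrite (bigD1 j0) //=.
have -> : (maxform f * maxform g) ^+ k =
    maxform f * maxform g * (maxform f * maxform g) ^+ k.-1.
  by rewrite -exprS prednK.
have -> : maxform (tens (conj_pattern a f j0) (conj_pattern b g j0)) =
    maxform (tens f g) by rewrite /conj_pattern aj bj.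
move=> H; rewrite -(ler_pM2r (exprn_gt0 k.-1 P_gt0)).
apply: le_trans H _; rewrite ler_wpM2l ?maxform_ge0 //.
apply: le_trans (_ : \prod_(j | j != j0) (maxform f * maxform g) <= _).
  apply: ler_prod => j _; rewrite maxform_ge0 /=.
  apply: le_trans (maxform_tens_le _ _) _.
  by rewrite ler_pM ?maxform_ge0 // maxform_conj_unless.
by rewrite prodr_const cardC1 card_ord.
Qed.

Lemma common_pattern : exists a : pattern, forall n (f : fn n),
  (0 < n)%N -> normc (mform (conj_pattern a f)) = maxform f.
Proof.
apply: contrapT => /forallNP bad.
(* Induction on the list of patterns to defeat, starting from the constant 1. Tensoring with a
   counterexample [f] to [a] defeats [a] through [f] and keeps the patterns of [s] defeated through
   [h]. *)
have fails (s : seq pattern) : exists n (h : fn n),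
    [/\ (0 < n)%N, 0 < maxform h &
    {in s, forall a, normc (mform (conj_pattern a h)) < maxform h}].
  elim: s => [|a s [n [h [n0 h0 hs]]]].
    exists 1%N, (fun=> 1); split=> //; rewrite lt_def maxform_ge0 andbT.
    apply/eqP => /(maxform_eq0 (isT : 0 < 1)%N) /(_ 0) /eqP.
    by rewrite oner_eq0.
  have [n' [f [n'0 fa]]] : exists n (f : fn n),
      (0 < n)%N /\ normc (mform (conj_pattern a f)) <> maxform f.
    apply: contrapT => H; apply: (bad a) => n1 f1 n10.
    by apply: contrapT => H1; apply: H; exists n1, f1.
  have fa_lt : normc (mform (conj_pattern a f)) < maxform f.
    by rewrite lt_neqAle le_maxform andbT; exact/eqP.
  have f0 : 0 < maxform f by apply: le_lt_trans fa_lt; exact: normc_ge0.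
  exists (n + n')%N, (tens h f).
  rewrite addn_gt0 n0 maxform_tens // mulr_gt0 //; split=> // b.
  rewrite inE mform_pattern_tens normcM => /orP[/eqP ->|/hs hb].
    apply: le_lt_trans (ler_wpM2r (normc_ge0 _) (le_maxform _ _)) _.
    by rewrite ltr_pM2l.
  apply: le_lt_trans (ler_wpM2l (normc_ge0 _) (le_maxform _ _)) _.
  by rewrite ltr_pM2r.
have [n [h [_ _ H]]] := fails (enum {: pattern}).
have [a ha] := maxform_attained h.
by have := H a; rewrite mem_enum -ha ltxx => /(_ isT).
Qed.

Lemma maxform_triangle n (f g : fn n) : (0 < n)%N ->
  maxform (fun x => f x + g x) `^ k%:R^-1 <=
  maxform f `^ k%:R^-1 + maxform g `^ k%:R^-1.
Proof.
move=> n0; have k0 := norming_gt0.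
rewrite powR_root_le ?maxform_ge0 ?addr_ge0 ?powR_ge0 //.
apply: maxform_leP => a.
pose h (b : bool) := if b then f else g.
rewrite (@eq_mform _ _ (fun j x => \sum_b conj_unless (a j) (h b x)));
  last first.
  by move=> j x; rewrite big_bool /conj_pattern conj_unlessD.
rewrite mform_sum; apply: le_trans (normc_sum _) _.
(* Holder bounds each word in [f] and [g] by a product of [k]-th roots; these products sum to the
   [k]-th power of the right-hand side. *)
apply: le_trans (_ :
  \sum_(w : pattern) \prod_j maxform (h (w j)) `^ k%:R^-1 <= _).
  apply: ler_sum => w _.
  rewrite -(ler_pXn2r k0) ?nnegrE ?normc_ge0 ?prodr_ge0 //; last first.
    by move=> j _; exact: powR_ge0.
  apply: le_trans (mform_holder _ n0) _; rewrite -prodrXl.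
  apply: ler_prod => j _; rewrite maxform_ge0 powR_rootK ?maxform_ge0 //.
  exact: maxform_conj_unless.
rewrite -(bigA_distr_bigA (fun _ b => maxform (h b) `^ k%:R^-1)) /=.
by rewrite prodr_const card_ord big_bool.
Qed.

End Norming.
End Forms.

Theorem theorem8p1 (R : realType) (F : finFieldType) (m k : nat)
    (L : 'M[F]_(m, k)) (hL : linear_system L) (hnorming : norming R L) :
  exists alpha : 'I_k -> bool, complex_norming R L alpha.
Proof.
have k0 := norming_gt0 hnorming.
have [a ha] := common_pattern hnorming.
exists a => n n0.
have tE (f : {ffun 'rV[F]_n -> R[i]}) :
    normc (t_complex L a f) = maxform L f by rewrite -(ha n f n0).
split=> [f|f|c f|f g]; cbv zeta; rewrite !tE.
- by rewrite lecR powR_ge0.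
- move=> /complexI /powR_eq0_eq0 /(maxform_eq0 hnorming n0) f0.
  by apply/ffunP => x; rewrite f0 ffunE.
- rewrite -[`|c|]/((normc c)%:C) -rmorphM; congr (_%:C).
  (* Equality holds because the single pattern [a] attains both maxima. *)
  have -> : maxform L (c *: f) = normc c ^+ k * maxform L f.
    rewrite -(ha _ _ n0) -(ha n f n0).
    rewrite (@eq_mform _ _ _ _ L n _ (fun j x => conj_unless (a j) c *
      conj_unless (a j) (f x))); last first.
      by move=> j x; rewrite /conj_pattern ffunE conj_unlessM.
    rewrite mformZ normcM normc_prod.
    under eq_bigr do rewrite normc_conj_unless.
    by rewrite prodr_const card_ord.
  by rewrite powRM ?exprn_ge0 ?normc_ge0 ?maxform_ge0 // powR_root ?normc_ge0.
- rewrite -rmorphD lecR.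
  have -> : maxform L (f + g) = maxform L (fun x => f x + g x).
    by rewrite -!(ha _ _ n0); congr normc; apply: eq_mform => j x;
      rewrite /conj_pattern ffunE.
  exact: maxform_triangle.
Qed.
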